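(* Let $\boldsymbol{d}=(d_1,\dots,d_n)$ be a graphical degree sequence with $d_1\geq d_2\geq\cdots\geq d_n\geq 3$, and let $\lambda\geq 1$ be a constant. Then the triangle switch chain with parameter $\lambda$ is irreducible on $\mathcal{G}(n,\boldsymbol{d})$: for any $G,H\in\mathcal{G}(n,\boldsymbol{d})$ there is a finite sequence of transitions of the chain, each of positive probability, leading from $G$ to $H$.
   Context: $\mathcal{G}(n,\boldsymbol{d})$ is the set of all labelled simple graphs on vertex set $[n]=\{1,\dots,n\}$ in which vertex $i$ has degree $d_i$ for all $i$. For a graph $G$, $t(G)$ is the number of triangles of $G$ and $N(a)$ is the neighbourhood of vertex $a$. The triangle switch chain with parameter $\lambda\geq1$ on $\mathcal{G}(n,\boldsymbol{d})$ has the following transition from the current state $G$: choose an unordered pair $F=\{a_1a_2,a_3a_4\}$ of vertex-disjoint edges of $G$ uniformly at random; choose one of the three perfect matchings $F'$ of $\{a_1,a_2,a_3,a_4\}$ uniformly at random; let $H$ be the graph with edge set $(E(G)\setminus F)\cup F'$. If $F'\cap(E(G)\setminus F)=\emptyset$ and for some pair $aa'\in F\cup F'$ the set $(N(a)\cap N(a'))\setminus\{a_1,a_2,a_3,a_4\}$ is nonempty, then move to $H$ with probability $\min\{1,\lambda^{t(H)-t(G)}\}$; otherwise stay at $G$. *)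

(* Defs.v *)
From mathcomp Require Import all_boot all_order all_algebra.
Set Implicit Arguments. Unset Strict Implicit. Unset Printing Implicit Defensive.
Import Order.TTheory GRing.Theory Num.Theory.

(* A labelled simple graph on vertex set 'I_n (= {0,...,n-1}, standing for [n])
   is given by its edge set: a set of 2-element subsets of 'I_n. *)
Definition graph (n : nat) := {set {set 'I_n}}.

Definition simple_graph n (G : graph n) : Prop :=
  forall e, e \in G -> #|e| = 2.

Definition adj n (G : graph n) (a b : 'I_n) : bool := [set a; b] \in G.

Definition nbhd n (G : graph n) (a : 'I_n) : {set 'I_n} := [set b | adj G a b].

Definition deg n (G : graph n) (v : 'I_n) : nat := #|[set e in G | v \in e]|.

Definition in_Gnd n (d : 'I_n -> nat) (G : graph n) : Prop :=
  simple_graph G /\ forall v, deg G v = d v.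

Definition triangles n (G : graph n) : nat :=
  #|[set T : {set 'I_n} | (#|T| == 3) &&
      [forall a in T, forall b in T, (a != b) ==> adj G a b]]|.

(* One transition of the triangle switch chain from G to H that has positive
   probability: a choice of an unordered pair F = {a1a2, a3a4} of vertex
   disjoint edges of G and a perfect matching F' of {a1,a2,a3,a4} such that the
   proposal is accepted (F' meets no edge of E(G)\F, some pair aa' of F u F'
   has a common neighbour outside {a1,...,a4}) and the acceptance probability
   min{1, lambda^(t(H)-t(G))} is positive, with H = (E(G)\F) u F'. *)
Definition tswitch_step (R : realFieldType) (lambda : R) n (G H : graph n) : Prop :=
  exists a1 a2 a3 a4 : 'I_n,
    [/\ uniq [:: a1; a2; a3; a4], adj G a1 a2 & adj G a3 a4] /\
    let F : graph n := [set [set a1; a2]; [set a3; a4]] in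
    let A : {set 'I_n} := [set a1; a2; a3; a4] in
    exists F' : graph n,
      [/\ F' \in [:: [set [set a1; a2]; [set a3; a4]];
                    [set [set a1; a3]; [set a2; a4]];
                    [set [set a1; a4]; [set a2; a3]]],
          F' :&: (G :\: F) = set0,
          (exists a a' : 'I_n, [set a; a'] \in F :|: F' /\
              (nbhd G a :&: nbhd G a') :\: A != set0),
          H = (G :\: F) :|: F' &
          (0 < Num.min 1 (lambda ^ ((triangles H)%:Z - (triangles G)%:Z)))%R].

Inductive tswitch_reach (R : realFieldType) (lambda : R) n (G : graph n)
  : graph n -> Prop :=
| tsr_refl : tswitch_reach lambda G G
| tsr_step : forall H K, tswitch_reach lambda G H -> tswitch_step lambda H K ->
    tswitch_reach lambda G K.

(* Main.v *)
(** Any two graphs with the same degrees are joined by ordinary switches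
    ab, cd -> ac, bd: the symmetric difference of two distinct graphs can always
    be decreased by a switch in one of them. It remains to simulate each such
    switch by triangle switches. If ad or bc is an edge, or some outside vertex
    is adjacent to two of a, b, c, d, this takes at most three steps. Otherwise
    the outside neighbourhoods of a, b, c, d are pairwise disjoint, and one either
    goes through a neighbour x of a (ax, cd -> ac, xd, then ab, xd -> ax, bd), or
    first performs a switch near a that creates an easy situation, then the wanted
    switch, then undoes the first one: whatever allowed the first switch is still
    there. The exception is a vertex adjacent to a neighbour of each of a, b, c, d,
    which is treated by five explicit switches. *)

Require Import Defs.
From mathcomp Require Import all_boot all_order all_algebra.
From mathcomp Require Import zify.
From Stdlib Require Import Btauto.
Import Order.TTheory GRing.Theory Num.Theory.
Local Open Scope nat_scope.

Set Implicit Arguments.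
Unset Strict Implicit.

(** * Switches as symmetric differences, and their effect on adjacency and degrees *)

(* The symmetric difference makes identities between composed switches linear
   over F_2, hence free of side conditions. *)
Definition sw n (G : graph n) (a b c d : 'I_n) : graph n :=
  [set e | (e \in G) (+) (e == [set a; b]) (+) (e == [set c; d])
                     (+) (e == [set a; c]) (+) (e == [set b; d])].

Definition switchable n (G : graph n) (a b c d : 'I_n) : bool :=
  [&& uniq [:: a; b; c; d], adj G a b, adj G c d, ~~ adj G a c & ~~ adj G b d].

Lemma adjC n (G : graph n) u v : adj G u v = adj G v u.
Proof. by rewrite /adj setUC. Qed.

Lemma set2_eq (T : finType) (u v a b : T) :
  ([set u; v] == [set a; b]) = ((u == a) && (v == b) || (u == b) && (v == a)).
Proof.
apply/eqP/orP; last by case=> /andP[/eqP-> /eqP->] //; rewrite setUC.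
move=> E.
have: u \in [set a; b] by rewrite -E set21.
have: v \in [set a; b] by rewrite -E set22.
have: a \in [set u; v] by rewrite E set21.
have: b \in [set u; v] by rewrite E set22.
rewrite !inE ![a == _]eq_sym ![b == _]eq_sym.
by do 4![case: (_ == _)] => //= *; auto.
Qed.

Lemma adj_sw n (G : graph n) a b c d u v :
  adj (sw G a b c d) u v =
    adj G u v (+) ((u == a) && (v == b) || (u == b) && (v == a))
              (+) ((u == c) && (v == d) || (u == d) && (v == c))
              (+) ((u == a) && (v == c) || (u == c) && (v == a))
              (+) ((u == b) && (v == d) || (u == d) && (v == b)).
Proof. by rewrite {1}/adj inE !set2_eq. Qed.

Lemma sw_comm n (G : graph n) a b c d a' b' c' d' :
  sw (sw G a b c d) a' b' c' d' = sw (sw G a' b' c' d') a b c d.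
Proof. by apply/setP => e; rewrite !inE; do ![case: (_ == _)]; case: (_ \in _). Qed.

Lemma sw_rev n (G : graph n) a b c d : sw (sw G a b c d) a c b d = G.
Proof. by apply/setP => e; rewrite !inE; do ![case: (_ == _)]; case: (_ \in _). Qed.

Lemma sw_sym1 n (G : graph n) a b c d : sw G b a d c = sw G a b c d.
Proof.
apply/setP => e; rewrite !inE [[set b; a]]setUC [[set d; c]]setUC.
by do ![case: (_ == _)]; case: (_ \in _).
Qed.

Lemma sw_sym2 n (G : graph n) a b c d : sw G c d a b = sw G a b c d.
Proof.
apply/setP => e; rewrite !inE [[set c; a]]setUC [[set d; b]]setUC.
by do ![case: (_ == _)]; case: (_ \in _).
Qed.

Ltac explode :=
  repeat match goal with
  | H : is_true (switchable _ _ _ _ _) |- _ => unfold switchable in H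
  | H : is_true (_ && _) |- _ => case/andP: H => ? ?
  | H : is_true (uniq _) |- _ => progress rewrite /= ?inE ?negb_or in H
  | H : is_true (_ \notin _) |- _ => progress rewrite ?inE ?negb_or in H
  | H : is_true true |- _ => clear H
  end.

Ltac look :=
  repeat match goal with
  | |- context [?x == ?x] => rewrite (eqxx x)
  | H : is_true (?x != ?y) |- context [?x == ?y] => rewrite (negbTE H)
  | H : is_true (?x != ?y) |- context [?y == ?x] => rewrite [y == x]eq_sym (negbTE H)
  | H : is_true (adj ?G ?x ?y) |- context [adj ?G ?x ?y] => rewrite H
  | H : is_true (adj ?G ?x ?y) |- context [adj ?G ?y ?x] => rewrite (adjC G y x) H
  | H : is_true (~~ adj ?G ?x ?y) |- context [adj ?G ?x ?y] => rewrite (negbTE H)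
  | H : is_true (~~ adj ?G ?x ?y) |- context [adj ?G ?y ?x] =>
      rewrite (adjC G y x) (negbTE H)
  end.

(** Once [look] has substituted the known equalities and adjacencies, few unknown adjacencies
    remain, and the Boolean goal is checked for all their values. *)
Ltac decide_adj :=
  explode; rewrite /switchable /= ?inE ?negb_or ?adj_sw; look;
  rewrite /= ?orbT ?andbT ?orbF ?andbF;
  repeat match goal with |- context [adj ?G ?x ?y] => case: (adj G x y) => //= end; done.

Lemma switchable_rev n (G : graph n) a b c d :
  switchable G a b c d -> switchable (sw G a b c d) a c b d.
Proof. by move=> S; decide_adj. Qed.

Lemma sw_replace n (G : graph n) a b c d : switchable G a b c d ->
  sw G a b c d =
    (G :\: [set [set a; b]; [set c; d]]) :|: [set [set a; c]; [set b; d]].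
Proof.
move=> S; explode; apply/setP => e; rewrite !inE.
have [->|n1] := eqVneq e [set a; b].
  by rewrite -/(adj G a b) ?set2_eq; look.
have [->|n2] := eqVneq e [set c; d].
  by rewrite -/(adj G c d) ?set2_eq; look.
have [->|n3] := eqVneq e [set a; c].
  by rewrite -/(adj G a c) ?set2_eq; look.
have [->|n4] := eqVneq e [set b; d].
  by rewrite -/(adj G b d) ?set2_eq; look.
by rewrite /= !addbF orbF.
Qed.

Lemma simple_sw n (G : graph n) a b c d :
  simple_graph G -> switchable G a b c d -> simple_graph (sw G a b c d).
Proof.
move=> sG S e; rewrite sw_replace //; explode; rewrite !inE.
by case/orP => [/andP[_ /sG]//|/orP[]/eqP->]; rewrite cards2; look.
Qed.

Lemma degE n (G : graph n) v : deg G v = \sum_(e in G) (v \in e).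
Proof.
rewrite /deg -sum1_card big_mkcond [RHS]big_mkcond; apply: eq_bigr => e _.
by rewrite inE; case: (e \in G); case: (v \in e).
Qed.

(** The removed pair of edges and the added one each cover [a], [b], [c], [d] exactly once; all
    other edges are common to both graphs. *)
Lemma deg_sw n (G : graph n) a b c d v :
  switchable G a b c d -> deg (sw G a b c d) v = deg G v.
Proof.
move=> S; rewrite !degE.
rewrite (big_setID [set [set a; c]; [set b; d]]) [RHS](big_setID [set [set a; b]; [set c; d]]) /=.
rewrite sw_replace //.
have -> : G :&: [set [set a; b]; [set c; d]] = [set [set a; b]; [set c; d]].
  by apply/setIidPr/subsetP=> e; rewrite !inE; explode=> /orP[]/eqP->.
have -> : (G :\: [set [set a; b]; [set c; d]] :|: [set [set a; c]; [set b; d]])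
    :\: [set [set a; c]; [set b; d]] = G :\: [set [set a; b]; [set c; d]].
  rewrite setDUl setDv setU0; apply/setDidPl; rewrite disjoints_subset.
  apply/subsetP => e; rewrite !inE => /andP[_ eG]; explode.
  by apply/negP=> /orP[]/eqP E; move: eG; rewrite E -/(adj _ _ _); look.
rewrite [(_ :|: _) :&: _]setIC setKU.
congr addn; rewrite !big_setU1 ?big_set1 /=; try by rewrite inE set2_eq; explode; look.
explode; rewrite !inE.
have [->|n1] := eqVneq v a; first by look.
have [->|n2] := eqVneq v b; first by look.
have [->|n3] := eqVneq v c; first by look.
by look.
Qed.

Lemma deg_nbhd n (G : graph n) v : simple_graph G -> deg G v = #|nbhd G v|.
Proof.
move=> sG; rewrite /deg -(@card_in_imset _ _ (fun u => [set v; u]) (mem (nbhd G v))).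
  apply: eq_card => e; rewrite !inE; apply/andP/imsetP.
    case=> eG ve; have /eqP/cards2P[x [y [_ E]]] := sG _ eG.
    move: ve; rewrite E !inE => /orP[]/eqP->.
      by exists y; rewrite // inE /adj -E.
    by exists x; rewrite ?inE /adj setUC -?E.
  by case=> u; rewrite inE => ? ->; rewrite set21.
move=> u w _ _ /eqP; rewrite set2_eq eqxx /= => /orP[/eqP//|/andP[/eqP-> /eqP->]] //.
Qed.

Lemma adj_irr n (G : graph n) u v : simple_graph G -> adj G u v -> u != v.
Proof. by move=> sG /sG; rewrite cards2; case: eqVneq. Qed.


(** * Minimum degree three, and sequences of triangle switches *)

Definition min3 n (G : graph n) := simple_graph G /\ forall v, 3 <= deg G v.

Lemma min3_sw n (G : graph n) a b c d :
  min3 G -> switchable G a b c d -> min3 (sw G a b c d).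
Proof. by move=> [sG dG] S; split=> [|v]; [apply: simple_sw | rewrite deg_sw]. Qed.

Lemma min3_nbr n (G : graph n) (v y z : 'I_n) : min3 G ->
  exists x, [&& adj G v x, x != y & x != z].
Proof.
move=> [sG /(_ v)]; rewrite deg_nbhd // (cardsD1 y) (cardsD1 z) => dv.
have /card_gt0P[x] : 0 < #|nbhd G v :\ y :\ z|.
  by move: dv; do 2!case: (_ \in _); case: #|_|.
by rewrite !inE => /and3P[? ? ?]; exists x; apply/and3P.
Qed.

(** The witness [v] must see both ends of [ab], [cd], [ac] or [bd]; the diagonals [ad] and [bc] do
    not count. The third perfect matching is covered by exchanging the names [c] and [d]. *)
Definition triangle_switch n (G H : graph n) := exists a b c d v,
  [/\ switchable G a b c d, v \notin [:: a; b; c; d],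
      [|| adj G v a && adj G v b, adj G v c && adj G v d,
          adj G v a && adj G v c | adj G v b && adj G v d]
    & H = sw G a b c d].

(** The same [v] works: it lies outside the four vertices, so its adjacencies are unchanged, and the
    reversed switch involves the same four pairs. *)
Lemma triangle_switch_sym n (G H : graph n) :
  triangle_switch G H -> triangle_switch H G.
Proof.
move=> [a [b [c [d [v [S vS vG ->]]]]]]; exists a, c, b, d, v.
split; rewrite ?sw_rev ?switchable_rev //; first by decide_adj.
explode; rewrite !adj_sw; look; rewrite /= ?andbF /= ?addbF.
by move: vG; do 4!case: (adj _ _ _).
Qed.

Inductive tconn n (G : graph n) : graph n -> Prop :=
| tconn_refl : tconn G G
| tconn_step H K : tconn G H -> triangle_switch H K -> tconn G K.

Lemma tconn_trans n (G H K : graph n) : tconn G H -> tconn H K -> tconn G K.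
Proof. by move=> GH; elim=> // H' K' _ GH' HK; apply: tconn_step HK. Qed.

Lemma tconn_sym n (G H : graph n) : tconn G H -> tconn H G.
Proof.
elim=> [|H' K _ IH /triangle_switch_sym HK]; first exact: tconn_refl.
by apply: tconn_trans IH; apply: tconn_step HK; apply: tconn_refl.
Qed.

Lemma tconn_sw n (G : graph n) a b c d v :
  switchable G a b c d -> v \notin [:: a; b; c; d] ->
  [|| adj G v a && adj G v b, adj G v c && adj G v d,
      adj G v a && adj G v c | adj G v b && adj G v d] ->
  tconn G (sw G a b c d).
Proof.
by move=> S vS vG; apply: tconn_step (tconn_refl _) _; exists a, b, c, d, v.
Qed.

(** Conjugation by an auxiliary switch: do it, do the wanted switch, undo it. Since switches
    commute, undoing can be proved as doing the auxiliary switch after the wanted one, read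
    backwards. *)
Lemma tconn_conj n (G : graph n) a b c d a' b' c' d' :
  tconn G (sw G a' b' c' d') ->
  tconn (sw G a' b' c' d') (sw (sw G a' b' c' d') a b c d) ->
  tconn (sw G a b c d) (sw (sw G a b c d) a' b' c' d') ->
  tconn G (sw G a b c d).
Proof.
move=> H1 H2 /tconn_sym H3; apply: tconn_trans H1 _.
by apply: tconn_trans H2 _; rewrite sw_comm.
Qed.

Lemma switchable_sym1 n (G : graph n) a b c d :
  switchable G a b c d -> switchable G b a d c.
Proof. by move=> S; decide_adj. Qed.

Lemma switchable_sym2 n (G : graph n) a b c d :
  switchable G a b c d -> switchable G c d a b.
Proof. by move=> S; decide_adj. Qed.

Lemma addbE b c : b (+) c = xorb b c.
Proof. by case: b; case: c. Qed.

Ltac xor_graph :=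
  apply/setP => e; rewrite !inE;
  repeat match goal with |- context [[set ?x; ?y]] =>
    match goal with |- context [[set y; x]] =>
      tryif constr_eq x y then fail else rewrite [[set y; x]]setUC
    end end;
  rewrite !addbE; btauto.

Ltac step v := apply: (@tconn_sw _ _ _ _ _ _ v); [decide_adj | decide_adj | decide_adj].

(** * Simulating a switch when a diagonal is an edge or has a common neighbour *)

(** A detour through the third matching [ad], [bc], either removed first and restored, or created
    first and removed. Both steps involve the pair [ad], which [v] sees. *)
Lemma tconn_diag_nbr n (G : graph n) a b c d v : switchable G a b c d ->
  adj G a d = adj G b c -> v \notin [:: a; b; c; d] -> adj G v a -> adj G v d ->
  tconn G (sw G a b c d).
Proof.
move=> S; case: (boolP (adj G b c)) => bc ad vS va vd.
  have {}ad : adj G a d by [].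
  have -> : sw G a b c d = sw (sw G a d c b) a b d c by xor_graph.
  by apply: (@tconn_trans _ _ (sw G a d c b)); step v.
have {}ad : ~~ adj G a d by rewrite ad.
have -> : sw G a b c d = sw (sw G a b d c) a d c b by xor_graph.
by apply: (@tconn_trans _ _ (sw G a b d c)); step v.
Qed.

(** Here [b] sees [a] and [c], witnessing [ax], [cd] -> [ac], [xd]; afterwards [c] sees [a] and [b],
    witnessing [ab], [xd] -> [ax], [bd]. *)
Lemma tconn_diag_asym n (G : graph n) a b c d x : switchable G a b c d ->
  adj G b c -> x \notin [:: a; b; c; d] -> adj G x a -> ~~ adj G x d ->
  tconn G (sw G a b c d).
Proof.
move=> S bc xS xa xd.
have -> : sw G a b c d = sw (sw G a x c d) a b x d by xor_graph.
by apply: (@tconn_trans _ _ (sw G a x c d)); [step b | step c].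
Qed.

(** The auxiliary switch [bc], [xy] -> [bx], [cy] makes [x] see both [a] and [b]. It is witnessed by
    [a] before the wanted switch and by [d] after it. *)
Lemma tconn_diag_escape n (G : graph n) a b c d x y : switchable G a b c d ->
  adj G b c -> uniq [:: a; b; c; d; x; y] -> adj G x a -> adj G x d ->
  ~~ adj G x b -> adj G x y -> ~~ adj G y c ->
  tconn G (sw G a b c d).
Proof.
move=> S bc U xa xd xb xy yc.
by apply: (@tconn_conj _ _ _ _ _ _ b c x y); [step a | step x | step d].
Qed.

(** The first two of the three switches use the pair [bc], seen by [y]; the last uses [ad], seen by
    [x']. *)
Lemma tconn_diag_prism n (G : graph n) a b c d x x' y : switchable G a b c d ->
  adj G b c -> ~~ adj G a d -> uniq [:: a; b; c; d; x; x'; y] ->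
  adj G x a -> adj G x d -> adj G x' a -> adj G x' d ->
  ~~ adj G x b -> adj G y b -> adj G y c ->
  tconn G (sw G a b c d).
Proof.
move=> S bc ad U xa xd x'a x'd xb yb yc.
have -> : sw G a b c d = sw (sw (sw G a x c b) a b d c) a d x b by xor_graph.
apply: (@tconn_trans _ _ (sw G a x c b)); first by step y.
by apply: (@tconn_trans _ _ (sw (sw G a x c b) a b d c)); [step y | step x'].
Qed.

Ltac contra_adj sG := exfalso; match goal with
  | H : is_true (adj ?G ?x ?x) |- _ => by move: (adj_irr sG H); rewrite eqxx
  | H : is_true (?x != ?x) |- _ => by rewrite eqxx in H
  | H1 : is_true (adj ?G ?x ?y), H2 : is_true (~~ adj ?G ?x ?y) |- _ =>
      by rewrite H1 in H2
  | H1 : is_true (adj ?G ?x ?y), H2 : is_true (~~ adj ?G ?y ?x) |- _ =>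
      by rewrite adjC H1 in H2
  end.

(** Two vertices are told apart by identifying them and finding a loop or a pair both adjacent and
    nonadjacent. *)
Ltac distinct sG :=
  explode; rewrite /= ?inE ?negb_or; repeat (apply/andP; split) => //;
  try (by rewrite eq_sym); apply/eqP => ?; subst; contra_adj sG.

Lemma tconn_diag_edge n (G : graph n) a b c d :
  min3 G -> switchable G a b c d -> adj G b c -> tconn G (sw G a b c d).
Proof.
move=> mG S bc; have sG := proj1 mG.
have [|nx] := boolP [exists x, (x \notin [:: a; b; c; d]) && (adj G x a != adj G x d)].
  case/existsP=> x /andP[xS]; case: (boolP (adj G x a)) => xa xd.
    by apply: (tconn_diag_asym S bc xS xa); case: (adj G x d) xd.
  rewrite -sw_sym1 -sw_sym2; apply: (@tconn_diag_asym _ _ _ _ _ _ x) => //.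
  - exact/switchable_sym2/switchable_sym1.
  - by rewrite adjC.
  - by decide_adj.
  - by case: (adj G x d) xd.
have [|nv] := boolP [exists v, (v \notin [:: a; b; c; d]) &&
    [|| adj G v a && adj G v b, adj G v c && adj G v d,
        adj G v a && adj G v c | adj G v b && adj G v d]].
  by case/existsP=> v /andP[vS]; apply: tconn_sw.
(* Outside the four vertices [a] and [d] now have the same neighbours, and none of these sees [b] or
   [c], as it would witness the switch. *)
have Na x : adj G a x -> x != b -> x != d ->
    [/\ x \notin [:: a; b; c; d], adj G x a, adj G x d, ~~ adj G x b & ~~ adj G x c].
  move=> ax xb xd.
  have xS : x \notin [:: a; b; c; d] by distinct sG.
  move: nx nv => /existsPn/(_ x); rewrite xS /= negbK => /eqP E /existsPn/(_ x).
  rewrite xS -E adjC ax /=.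
  by case: (adj G x b); case: (adj G x c).
have [x /and3P[ax xb xd]] := min3_nbr a b d mG.
have [xS xa xd' xb' xc] := Na _ ax xb xd.
have [ad|ad] := boolP (adj G a d).
  by apply: (@tconn_diag_nbr _ _ _ _ _ _ x); rewrite ?ad ?bc.
(* As [ad] is not an edge, the third neighbour of [a] is a second common neighbour of [a] and
   [d]. *)
have [x' /and3P[ax' x'b x'x]] := min3_nbr a b x mG.
have x'd : x' != d by apply: contraNneq ad => <-.
have [x'S x'a x'd' x'b' x'c] := Na _ ax' x'b x'd.
have [y /and3P[xy ya yd]] := min3_nbr x a d mG.
have U : uniq [:: a; b; c; d; x; y] by distinct sG.
have [yc|yc] := boolP (adj G y c); last first.
  exact: (@tconn_diag_escape _ _ _ _ _ _ x y).
have [yb|yb] := boolP (adj G y b); last first.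
  (* The same escape after exchanging [a] with [d] and [b] with [c]. *)
  rewrite -sw_sym1 -sw_sym2; apply: (@tconn_diag_escape _ _ _ _ _ _ x y) => //.
  - exact/switchable_sym2/switchable_sym1.
  - by rewrite adjC.
  - by decide_adj.
apply: (@tconn_diag_prism _ _ _ _ _ _ x x' y) => //.
by distinct sG.
Qed.

(** * Easy situations *)

Definition good n (G : graph n) (a b c d : 'I_n) :=
  [|| adj G a d, adj G b c |
      [exists v, (v \notin [:: a; b; c; d]) && (1 < count (adj G v) [:: a; b; c; d])]].

(** When neither diagonal is an edge, two vertices seen by [v] form either a pair that makes this a
    triangle switch, or a diagonal, to which [tconn_diag_nbr] applies. *)
Lemma tconn_good n (G : graph n) a b c d :
  min3 G -> switchable G a b c d -> good G a b c d -> tconn G (sw G a b c d).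
Proof.
move=> mG S; have S' := switchable_sym1 S.
have [ad _|ad] := boolP (adj G a d); first by rewrite -sw_sym1; apply: tconn_diag_edge.
have [bc _|bc] := boolP (adj G b c); first exact: tconn_diag_edge.
rewrite /good (negbTE ad) (negbTE bc) => /existsP[v /andP[vS] /= vn].
have [|nv] := boolP [|| adj G v a && adj G v b, adj G v c && adj G v d,
        adj G v a && adj G v c | adj G v b && adj G v d]; first exact: tconn_sw.
have [/andP[va vd]|nad] := boolP (adj G v a && adj G v d).
  by apply: (@tconn_diag_nbr _ _ _ _ _ _ v); rewrite ?(negbTE ad) ?(negbTE bc).
rewrite -sw_sym1; apply: (@tconn_diag_nbr _ _ _ _ _ _ v) => //.
- by rewrite (negbTE ad) (negbTE bc).
- by decide_adj.
- by move: vn nv nad; do 4![case: (adj _ _ _) => //].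
- by move: vn nv nad; do 4![case: (adj _ _ _) => //].
Qed.

Lemma goodW n (G : graph n) a b c d v :
  [|| adj G a d, adj G b c |
      (v \notin [:: a; b; c; d]) && (1 < count (adj G v) [:: a; b; c; d])] ->
  good G a b c d.
Proof.
case/or3P => H; apply/or3P; [by constructor 1 | by constructor 2|].
by constructor 3; apply/existsP; exists v.
Qed.

Ltac solve_min3 := repeat (apply: min3_sw; [|decide_adj]); assumption.

Ltac good_step v :=
  apply: tconn_good; [solve_min3 | decide_adj | apply: (@goodW _ _ _ _ _ _ v); decide_adj].

(** * Explicit reductions of a hard switch to easy ones *)

(** The route through [x]: both of its switches involve [a], [d] and [x], and [y] sees [x] together
    with [a] or [d]. *)
Lemma tconn_nbr_edge n (G : graph n) a b c d x y :
  min3 G -> switchable G a b c d -> uniq [:: a; b; c; d; x; y] ->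
  adj G x a -> ~~ adj G x d -> adj G x y -> adj G y a || adj G y d ->
  tconn G (sw G a b c d).
Proof.
move=> mG S U xa xd xy yad.
have -> : sw G a b c d = sw (sw G a x c d) a b x d by xor_graph.
by case/orP: yad => ?; apply: (@tconn_trans _ _ (sw G a x c d)); good_step y.
Qed.

(** Conjugation by [xz], [sp] -> [xs], [zp], after which [x] sees [a] and [s]. The auxiliary switch
    is easy in both directions because its diagonal [zs] is an edge. *)
Lemma tconn_cross_edge n (G : graph n) a b c d s x z p :
  min3 G -> switchable G a b c d -> uniq [:: a; b; c; d; x; z; p] ->
  s \in [:: b; c; d] -> adj G x a -> ~~ adj G x s -> adj G z s -> adj G p s ->
  adj G x z -> ~~ adj G z p ->
  tconn G (sw G a b c d).
Proof.
move=> mG S U; rewrite !inE => /or3P[]/eqP-> xa xs zs ps xz zp.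
- by apply: (@tconn_conj _ _ _ _ _ _ x z b p); good_step x.
- by apply: (@tconn_conj _ _ _ _ _ _ x z c p); good_step x.
- by apply: (@tconn_conj _ _ _ _ _ _ x z d p); good_step x.
Qed.

(** Conjugation by [xz], [st] -> [xs], [zt], which [w] permits by seeing [x] and [z]; then [x] sees
    [a] and [s]. *)
Lemma tconn_nbr_triangle n (G : graph n) a b c d s x z w t :
  min3 G -> switchable G a b c d -> uniq [:: a; b; c; d; x; z; w; t] ->
  s \in [:: b; c; d] -> adj G x a -> ~~ adj G x s -> adj G t s ->
  adj G x z -> adj G w x -> adj G w z -> ~~ adj G z t ->
  tconn G (sw G a b c d).
Proof.
move=> mG S U; rewrite !inE => /or3P[]/eqP-> xa xs ts xz wx wz zt.
- by apply: (@tconn_conj _ _ _ _ _ _ x z b t); [good_step w|good_step x|good_step w].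
- by apply: (@tconn_conj _ _ _ _ _ _ x z c t); [good_step w|good_step x|good_step w].
- by apply: (@tconn_conj _ _ _ _ _ _ x z d t); [good_step w|good_step x|good_step w].
Qed.

(** Each of the five switches removes or adds an edge with both ends among [x], [q], [p], [r], so
    [z] witnesses them all. *)
Lemma tconn_hub n (G : graph n) a b c d x q p r z :
  switchable G a b c d -> uniq [:: a; b; c; d; x; q; p; r; z] ->
  adj G x a -> adj G q b -> adj G p c -> adj G r d ->
  adj G z x -> adj G z q -> adj G z p -> adj G z r ->
  ~~ adj G x p -> ~~ adj G q r -> ~~ adj G p r -> ~~ adj G p b ->
  tconn G (sw G a b c d).
Proof.
move=> S U xa qb pc rd zx zq zp zr xp qr pr pb.
have -> : sw G a b c d =
  sw (sw (sw (sw (sw G a x c p) b q d r) a b x p) b p q r) p r c d by xor_graph.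
apply: (@tconn_trans _ _ (sw (sw (sw (sw G a x c p) b q d r) a b x p) b p q r)); last by step z.
apply: (@tconn_trans _ _ (sw (sw (sw G a x c p) b q d r) a b x p)); last by step z.
apply: (@tconn_trans _ _ (sw (sw G a x c p) b q d r)); last by step z.
by apply: (@tconn_trans _ _ (sw G a x c p)); step z.
Qed.

(** Conjugation by [xz], [x'z'] -> [xx'], [zz'], witnessed by [a]; it joins two neighbours of
    [a]. *)
Lemma tconn_two_paths n (G : graph n) a b c d x x' z z' :
  min3 G -> switchable G a b c d -> uniq [:: a; b; c; d; x; x'; z; z'] ->
  adj G x a -> adj G x' a -> ~~ adj G x d -> ~~ adj G x x' ->
  adj G z x -> adj G z' x' -> ~~ adj G z z' ->
  tconn G (sw G a b c d).
Proof.
move=> mG S U xa x'a xd xx' zx zx' zz'.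
apply: (@tconn_conj _ _ _ _ _ _ x z x' z'); [step a| |step a].
by apply: (@tconn_nbr_edge _ _ _ _ _ _ x x'); first solve_min3; decide_adj.
Qed.

(** Conjugation by [x z1], [z' x'] -> [x z'], [z1 x'] hands [z1] over to [x']; then [z2] and [z1]
    are the nonadjacent ends of two paths from [a]. *)
Lemma tconn_linked_paths n (G : graph n) a b c d x x' z1 z2 z' :
  min3 G -> switchable G a b c d -> uniq [:: a; b; c; d; x; x'; z1; z2; z'] ->
  adj G x a -> adj G x' a -> ~~ adj G x d -> ~~ adj G x x' ->
  adj G z1 x -> adj G z2 x -> ~~ adj G z1 z2 ->
  adj G z' x' -> adj G z1 z' -> ~~ adj G x z' -> ~~ adj G x' z1 ->
  tconn G (sw G a b c d).
Proof.
move=> mG S U xa x'a xd xx' z1x z2x z12 zx' z1z' xz' x'z1.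
apply: (@tconn_conj _ _ _ _ _ _ x z1 z' x'); [good_step a| |good_step a].
by apply: (@tconn_two_paths _ _ _ _ _ _ x x' z2 z1); first solve_min3; decide_adj.
Qed.

(** * Symmetries, and the case analysis for an arbitrary switch *)

Lemma good_sym1 n (G : graph n) a b c d : good G b a d c = good G a b c d.
Proof.
rewrite /good [RHS]orbCA; congr [|| _, _ | _]; apply: eq_existsb => v.
rewrite !inE /= !negb_or; congr (_ && (_ < _)); last by lia.
by do 4!case: (_ == _).
Qed.

Lemma good_sym2 n (G : graph n) a b c d : good G c d a b = good G a b c d.
Proof.
rewrite /good [RHS]orbCA adjC (adjC G d); congr [|| _, _ | _]; apply: eq_existsb => v.
rewrite !inE /= !negb_or; congr (_ && (_ < _)); last by lia.
by do 4!case: (_ == _).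
Qed.

Lemma reroot n (G : graph n) a b c d s :
  switchable G a b c d -> s \in [:: a; b; c; d] -> exists b' c' d',
  [/\ switchable G s b' c' d', good G s b' c' d' = good G a b c d,
      sw G s b' c' d' = sw G a b c d & [:: s; b'; c'; d'] =i [:: a; b; c; d]].
Proof.
move=> S; rewrite !inE => /or4P[]/eqP->.
- by exists b, c, d.
- exists a, d, c; split; [exact: switchable_sym1 | exact: good_sym1 | exact: sw_sym1 |].
  by move=> v; rewrite !inE; do 4!case: (_ == _).
- exists d, a, b; split; [exact: switchable_sym2 | exact: good_sym2 | exact: sw_sym2 |].
  by move=> v; rewrite !inE; do 4!case: (_ == _).
- exists c, b, a; split; [exact/switchable_sym2/switchable_sym1 | | |].
  + by rewrite good_sym1 good_sym2.
  + by rewrite sw_sym1 sw_sym2.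
  + by move=> v; rewrite !inE; do 4!case: (_ == _).
Qed.

Lemma not_good_nbr n (G : graph n) a b c d v s t :
  uniq [:: a; b; c; d] -> ~~ good G a b c d -> v \notin [:: a; b; c; d] ->
  s \in [:: a; b; c; d] -> t \in [:: a; b; c; d] -> adj G v s -> adj G v t -> s = t.
Proof.
move=> U ng vS sS tS vs vt; apply/eqP; apply: contraNT ng => st.
apply: (@goodW _ _ _ _ _ _ v); rewrite vS -size_filter.
apply/or3P; constructor 3; apply: (@leq_trans (size [:: s; t])) => //.
apply: uniq_leq_size; first by rewrite /= inE st.
by move=> w /[!inE] /orP[]/eqP->; rewrite mem_filter ?vs ?vt.
Qed.

(** Among the four vertices [s] sees only its partner in the switch, so at least two of its
    neighbours lie outside. *)
Lemma not_good_out n (G : graph n) a b c d s y :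
  min3 G -> switchable G a b c d -> ~~ good G a b c d -> s \in [:: a; b; c; d] ->
  exists p, [/\ p \notin [:: a; b; c; d], adj G p s & p != y].
Proof.
move=> mG S ng sS; have [b' [c' [d' [S' E _ E']]]] := reroot S sS.
have sG := proj1 mG.
have [p /and3P[sp pb py]] := min3_nbr s b' y mG.
move: ng; rewrite -E /good !negb_or => /and3P[nsd _ _].
exists p; split; rewrite // 1?adjC // -E'.
by distinct sG.
Qed.

Lemma tconn_same_nbr n (G : graph n) a b c d x y :
  min3 G -> switchable G a b c d -> ~~ good G a b c d ->
  x \notin [:: a; b; c; d] -> y \notin [:: a; b; c; d] ->
  adj G x a -> adj G y a -> adj G x y -> tconn G (sw G a b c d).
Proof.
move=> mG S ng xS yS xa ya xy; have sG := proj1 mG.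
have xd : ~~ adj G x d.
  apply/negP=> xd; have := not_good_nbr (proj1 (andP S)) ng xS _ _ xa xd.
  by rewrite !inE !eqxx !orbT => /(_ isT isT); explode; move/eqP; look.
apply: (@tconn_nbr_edge _ _ _ _ _ _ x y); rewrite ?ya //.
by distinct sG.
Qed.

(** After renaming [s] as the first vertex, another outside neighbour [p] of [t] decides: if [y]
    sees [p], two neighbours of [t] are adjacent, otherwise [tconn_cross_edge] applies. *)
Lemma tconn_linked n (G : graph n) a b c d x y s t :
  min3 G -> switchable G a b c d -> ~~ good G a b c d ->
  x \notin [:: a; b; c; d] -> y \notin [:: a; b; c; d] ->
  s \in [:: a; b; c; d] -> t \in [:: a; b; c; d] ->
  adj G x s -> adj G y t -> adj G x y -> tconn G (sw G a b c d).
Proof.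
move=> mG S ng xS yS sS tS xs yt xy; have sG := proj1 mG.
have [b' [c' [d' [S' Eg <- Ein]]]] := reroot S sS.
move: ng xS yS tS; rewrite -Eg -!Ein => {a b c d S sS Eg Ein} ng xS yS tS.
have U := proj1 (andP S').
have [ts|ts] := eqVneq t s; first by subst t; apply: (@tconn_same_nbr _ _ _ _ _ _ x y).
have [p [pS pt py]] := not_good_out y mG S' ng tS.
have [yp|yp] := boolP (adj G y p).
  have [b [c [d [S Eg <- Ein]]]] := reroot S' tS.
  by apply: (@tconn_same_nbr _ _ _ _ _ _ y p); rewrite ?Eg ?Ein.
have nx : ~~ adj G x t.
  apply: contraNN ts => xt; apply/eqP.
  by apply: (not_good_nbr U ng xS tS _ xt xs); rewrite mem_head.
have np : ~~ adj G p s.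
  apply: contraNN ts => ps; apply/eqP.
  by apply: (not_good_nbr U ng pS tS _ pt ps); rewrite mem_head.
have ny : ~~ adj G y s.
  apply: contraNN ts => ps; apply/eqP.
  by apply: (not_good_nbr U ng yS tS _ yt ps); rewrite mem_head.
apply: (@tconn_cross_edge _ _ _ _ _ _ t x y p) => //.
  by clear tS; distinct sG.
by move: tS; rewrite in_cons (negbTE ts).
Qed.

Lemma tconn_switch n (G : graph n) a b c d :
  min3 G -> switchable G a b c d -> tconn G (sw G a b c d).
Proof.
move=> mG S; have sG := proj1 mG; have U := proj1 (andP S).
have [|ng] := boolP (good G a b c d); first exact: tconn_good.
set S4 := [:: a; b; c; d] in U.
have [aS bS cS dS] : [/\ a \in S4, b \in S4, c \in S4 & d \in S4].
  by rewrite !inE !eqxx !orbT.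
have [|nl] := boolP [exists x, exists y, [&& x \notin S4, y \notin S4, adj G x y,
    has (adj G x) S4 & has (adj G y) S4]].
  case/existsP=> x /existsP[y /and5P[xS yS xy /hasP[s sS xs] /hasP[t tS yt]]].
  exact: (@tconn_linked _ _ _ _ _ _ x y s t).
have indep x y s t : x \notin S4 -> y \notin S4 -> s \in S4 -> t \in S4 ->
    adj G x s -> adj G y t -> ~~ adj G x y.
  move=> xS yS sS tS xs yt; apply: contraNN nl => xy.
  apply/existsP; exists x; apply/existsP; exists y.
  by apply/and5P; split=> //; apply/hasP; [exists s | exists t].
have nbr1 v s t : v \notin S4 -> s \in S4 -> t \in S4 -> adj G v s -> s != t ->
    ~~ adj G v t.
  by move=> vS sS tS vs; apply: contraNN => vt; rewrite (not_good_nbr U ng vS sS tS vs vt).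
have [ab ac ad bc [bd cd]] : [/\ a != b, a != c, a != d, b != c & b != d /\ c != d].
  by move: U; rewrite /S4; explode; split.
have out2 x z : x \notin S4 -> adj G x a -> adj G x z -> z != a ->
    z \notin S4 /\ forall s, s \in S4 -> ~~ adj G z s.
  move=> xS xa xz za.
  have zS : z \notin S4.
    apply/negP => zS; have := nbr1 _ _ _ xS aS zS xa; rewrite xz eq_sym => /(_ za).
    by [].
  split=> // s sS; apply/negP => zs.
  by have := indep x z a s xS zS aS sS xa zs; rewrite xz.
have [x [xS xa _]] := not_good_out a mG S ng aS.
have [x' [x'S x'a x'x]] := not_good_out x mG S ng aS.
have xx' := indep _ _ _ _ xS x'S aS aS xa x'a.
have [z1 /and3P[xz1 z1a _]] := min3_nbr x a a mG.
have [z2 /and3P[xz2 z2a z21]] := min3_nbr x a z1 mG.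
have [z1S z1n] := out2 _ _ xS xa xz1 z1a.
have [z2S z2n] := out2 _ _ xS xa xz2 z2a.
(* A triangle at [x] avoiding [a] suffices: either [w1] misses one of the chosen neighbours [q],
   [p], [r] of [b], [c], [d], or it sees all of them and is a hub. *)
have tri w1 w2 : adj G x w1 -> w1 != a -> adj G x w2 -> w2 != a -> adj G w1 w2 ->
    tconn G (sw G a b c d).
  move=> xw1 w1a xw2 w2a w12.
  have [w1S w1n] := out2 _ _ xS xa xw1 w1a.
  have [w2S w2n] := out2 _ _ xS xa xw2 w2a.
  have [q [qS qb _]] := not_good_out a mG S ng bS.
  have [p [pS pc _]] := not_good_out a mG S ng cS.
  have [r [rS rd _]] := not_good_out a mG S ng dS.
  have xp := indep _ _ _ _ xS pS aS cS xa pc.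
  have pr := indep _ _ _ _ pS rS cS dS pc rd.
  have qr := indep _ _ _ _ qS rS bS dS qb rd.
  have xb := nbr1 _ _ _ xS aS bS xa ab.
  have xc := nbr1 _ _ _ xS aS cS xa ac.
  have xd := nbr1 _ _ _ xS aS dS xa ad.
  have qc := nbr1 _ _ _ qS bS cS qb bc.
  have qd := nbr1 _ _ _ qS bS dS qb bd.
  have pd := nbr1 _ _ _ pS cS dS pc cd.
  have pb : ~~ adj G p b by apply: (nbr1 _ _ _ pS cS bS pc); rewrite eq_sym.
  have far s t : t \notin S4 -> s \in [:: b; c; d] -> adj G t s -> ~~ adj G w1 t ->
      tconn G (sw G a b c d).
    move=> tS s3 ts w1t.
    have sS : s \in S4 by rewrite in_cons s3 orbT.
    have sa : a != s by apply: contraTneq s3 => <-; rewrite !inE !negb_or ab ac ad.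
    have xs := nbr1 _ _ _ xS aS sS xa sa.
    have w1s := w1n s sS; have w2s := w2n s sS.
    apply: (@tconn_nbr_triangle _ _ _ _ _ _ s x w1 w2 t) => //; last by rewrite adjC.
      by clear s3 sS; move: xS tS w1S w2S; rewrite /S4 => *; distinct sG.
    by rewrite adjC.
  have [w1q|] := boolP (adj G w1 q); last by apply: (far b); rewrite // !inE eqxx.
  have [w1p|] := boolP (adj G w1 p); last by apply: (far c); rewrite // !inE eqxx orbT.
  have [w1r|] := boolP (adj G w1 r); last by apply: (far d); rewrite // !inE eqxx !orbT.
  apply: (@tconn_hub _ _ _ _ _ _ x q p r w1) => //; last by rewrite adjC.
  have w1b := w1n b bS; have w1c := w1n c cS; have w1d := w1n d dS.
  by move: xS qS pS rS w1S; rewrite /S4 => *; distinct sG.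
have xd := nbr1 _ _ _ xS aS dS xa ad.
have z1na := z1n a aS; have z2na := z2n a aS.
have [|z12] := boolP (adj G z1 z2); first exact: tri.
have far5 z z' : adj G x z -> z != a -> adj G x' z' -> z' != a -> z != z' ->
    ~~ adj G z z' -> tconn G (sw G a b c d).
  move=> xz za xz' z'a zz' nzz'.
  have [zS zn] := out2 _ _ xS xa xz za; have zna := zn a aS.
  have [z'S z'n] := out2 _ _ x'S x'a xz' z'a; have z'na := z'n a aS.
  apply: (@tconn_two_paths _ _ _ _ _ _ x x' z z') => //; try by rewrite adjC.
  by move: xS x'S zS z'S; rewrite /S4 => *; distinct sG.
(* If [x'] sees [z1], the paths from [a] through [x] to [z2] and through [x'] to [z1] have
   nonadjacent ends. *)
have [x'z1|x'z1] := boolP (adj G x' z1).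
  by apply: (far5 z2 z1); rewrite // adjC.
have [z' /and3P[x'z' z'a _]] := min3_nbr x' a a mG.
have z'z1 : z1 != z' by apply: contraNneq x'z1 => ->.
have [z1z'|z1z'] := boolP (adj G z1 z'); last exact: (far5 z1 z').
have [xz'|xz'] := boolP (adj G x z'); first exact: (tri z1 z').
have [z'S z'n] := out2 _ _ x'S x'a x'z' z'a; have z'na := z'n a aS.
apply: (@tconn_linked_paths _ _ _ _ _ _ x x' z1 z2 z') => //; try by rewrite adjC.
by move: xS x'S z1S z2S z'S; rewrite /S4 => *; distinct sG.
Qed.

(** * Ordinary switches connect all graphs with the same degrees *)

Lemma card_nbhd n (G : graph n) v : #|nbhd G v| = \sum_(t : 'I_n) adj G t v.
Proof.
rewrite -sum1_card big_mkcond; apply: eq_bigr => t _.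
by rewrite inE adjC; case: (adj _ _ _).
Qed.

(* If both alternatives fail, the sum over t of [t ~ w in G] + [t ~ u in H] is less
   than the one with G and H exchanged, though both are deg u + deg w. *)
Lemma exists_switch_partner n (G H : graph n) v u w :
  simple_graph G -> simple_graph H -> (forall x, #|nbhd G x| = #|nbhd H x|) ->
  adj G v u -> ~~ adj H v u -> adj H v w -> ~~ adj G v w ->
  (exists t, [&& t \notin [:: v; u; w], adj G t w, ~~ adj G t u &
              ~~ (adj H t w && ~~ adj H t u)]) \/
  (exists t, [&& t \notin [:: v; u; w], adj H t u, ~~ adj H t w &
              ~~ (adj G t u && ~~ adj G t w)]).
Proof.
move=> sG sH dGH Gvu Hvu Hvw Gvw.
have [/existsP|/existsPn nG] := boolP [exists t, [&& t \notin [:: v; u; w],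
    adj G t w, ~~ adj G t u & ~~ (adj H t w && ~~ adj H t u)]]; first by left.
have [/existsP|/existsPn nH] := boolP [exists t, [&& t \notin [:: v; u; w],
    adj H t u, ~~ adj H t w & ~~ (adj G t u && ~~ adj G t w)]]; first by right.
have vu := adj_irr sG Gvu; have vw := adj_irr sH Hvw.
have uw : u != w by apply: contraNneq Gvw => <-.
have irr K z : simple_graph K -> adj K z z = false.
  by move=> sK; apply/negP=> /(adj_irr sK); rewrite eqxx.
have: \sum_t (adj G t w + adj H t u) = \sum_t (adj H t w + adj G t u).
  by rewrite !big_split -!card_nbhd /= !dGH addnC.
(* The term at [v] is 0 on the left and 2 on the right, while those at [u] and [w] have equal
   totals; all other terms compare one by one. *)
rewrite (bigD1 v) // (bigD1 u) 1?eq_sym // (bigD1 w) /=; last by rewrite ![w == _]eq_sym vw uw.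
rewrite [RHS](bigD1 v) // [X in _ = _ + X](bigD1 u) 1?eq_sym //=.
rewrite [X in _ = _ + (_ + X)](bigD1 w) /=; last by rewrite ![w == _]eq_sym vw uw.
rewrite Gvu Hvw (negbTE Hvu) (negbTE Gvw) !irr // ![adj _ w u]adjC.
set s1 := \sum_(i | _) _; set s2 := \sum_(i | _) _.
suff: s1 <= s2 by lia.
apply: leq_sum => t /andP[/andP[tv tu] tw].
move: (nG t) (nH t); rewrite !inE !negb_or tv tu tw /=.
by do 4!case: (adj _ _ _).
Qed.

Definition gdiff n (G H : graph n) : graph n := [set e | (e \in G) (+) (e \in H)].

Lemma gdiffC n (G H : graph n) : gdiff G H = gdiff H G.
Proof. by apply/setP=> e; rewrite !inE addbC. Qed.

(** The difference loses [vu], [vw] and one more pair [s], and gains at most one pair [o]; which of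
    [ut], [wt] is [s] depends on whether [tw] is an edge of [H]. *)
Lemma gdiff_sw n (G H : graph n) v u w t :
  switchable G v u w t -> ~~ adj H v u -> adj H v w -> ~~ (adj H t w && ~~ adj H t u) ->
  #|gdiff (sw G v u w t) H| < #|gdiff G H|.
Proof.
move=> S Hvu Hvw Ht.
have [s [o [so sD Dsub]]] : exists s o, [/\ (s != [set v; u]) && (s != [set v; w]),
    s \in gdiff G H & gdiff (sw G v u w t) H \subset o |: (gdiff G H :\ [set v; u] :\ [set v; w] :\ s)].
  have aux e : (e \in gdiff (sw G v u w t) H) = (e \in gdiff G H) (+) (e == [set v; u])
      (+) (e == [set w; t]) (+) (e == [set v; w]) (+) (e == [set u; t]).
    by rewrite !inE !addbE; btauto.
  have Gin x y : ([set x; y] \in gdiff G H) = adj G x y (+) adj H x y by rewrite inE.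
  have [tw|tw] := boolP (adj H t w).
    exists [set u; t], [set w; t]; rewrite !set2_eq Gin; split.
    - by decide_adj.
    - by move: Ht; rewrite tw negbK adjC => tu; explode; look.
    apply/subsetP => e; rewrite aux !in_setU1 !in_setD1.
    have [->|n1] := eqVneq e [set v; u].
      by rewrite !set2_eq Gin; explode; look.
    have [->|n2] := eqVneq e [set v; w].
      by rewrite !set2_eq Gin; explode; look.
    have [->|n3] := eqVneq e [set u; t].
      by move: Ht; rewrite tw negbK !set2_eq Gin => Ht; explode; look.
    by case: (_ == _); rewrite /= ?addbF.
  exists [set w; t], [set u; t]; rewrite !set2_eq Gin; split.
  - by decide_adj.
  - by explode; look.
  apply/subsetP => e; rewrite aux !in_setU1 !in_setD1.
  have [->|n1] := eqVneq e [set v; u].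
    by rewrite !set2_eq Gin; explode; look.
  have [->|n2] := eqVneq e [set v; w].
    by rewrite !set2_eq Gin; explode; look.
  have [->|n3] := eqVneq e [set w; t].
    by rewrite !set2_eq Gin; explode; look.
  by case: (_ == _); rewrite /= ?addbF.
have [vuD vwD] : [set v; u] \in gdiff G H /\ [set v; w] \in gdiff G H.
  by rewrite !inE -!/(adj _ _ _); explode; look.
have wu : [set v; w] != [set v; u] by rewrite set2_eq; explode; look.
have := subset_leq_card Dsub; rewrite cardsU1.
have := cardsD1 [set v; u] (gdiff G H); have := cardsD1 [set v; w] (gdiff G H :\ [set v; u]).
have := cardsD1 s (gdiff G H :\ [set v; u] :\ [set v; w]).
case/andP: so => s1 s2; rewrite !in_setD1 s1 s2 sD vuD vwD wu /= => -> -> ->.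
by move/leq_ltn_trans; apply; rewrite !addnA ltn_add2r; case: (~~ _).
Qed.

Lemma in_Gnd_sw n (d : 'I_n -> nat) (G : graph n) a b c e :
  in_Gnd d G -> switchable G a b c e -> in_Gnd d (sw G a b c e).
Proof. by move=> [sG dG] S; split=> [|v]; [apply: simple_sw | rewrite deg_sw]. Qed.

Lemma exists_gdiff_sw n (d : 'I_n -> nat) (G H : graph n) :
  in_Gnd d G -> in_Gnd d H -> G != H -> exists v u w t,
  switchable G v u w t /\ #|gdiff (sw G v u w t) H| < #|gdiff G H| \/
  switchable H v u w t /\ #|gdiff (sw H v u w t) G| < #|gdiff G H|.
Proof.
move=> [sG dG] [sH dH] GH.
have dGH x : #|nbhd G x| = #|nbhd H x| by rewrite -!deg_nbhd // dG dH.
have [v nv] : exists v, nbhd G v != nbhd H v.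
  apply/existsP; apply: contraNT GH => /existsPn E.
  apply/eqP/setP => e.
  have aE x y : adj G x y = adj H x y.
    by move: (E x); rewrite negbK => /eqP/setP/(_ y); rewrite !inE.
  have [/cards2P[x [y [_ ->]]]|ne] := boolP (#|e| == 2); first exact: aE.
  by apply/idP/idP => [/sG|/sH] /eqP; rewrite (negbTE ne).
have [u uGH] : exists u, u \in nbhd G v :\: nbhd H v.
  apply/set0Pn; apply: contraNN nv; rewrite setD_eq0 => sub.
  by rewrite eqEcard sub dGH leqnn.
have [w wHG] : exists w, w \in nbhd H v :\: nbhd G v.
  apply/set0Pn; apply: contraNN nv; rewrite setD_eq0 => sub.
  by rewrite eq_sym eqEcard sub dGH leqnn.
move: uGH wHG; rewrite !inE => /andP[Hvu Gvu] /andP[Gvw Hvw].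
have vu := adj_irr sG Gvu; have vw := adj_irr sH Hvw.
have uw : u != w by apply: contraNneq Gvw => <-.
have [[t /and4P[tn tw tu Ht]]|[t /and4P[tn tu tw Gt]]] :=
  exists_switch_partner sG sH dGH Gvu Hvu Hvw Gvw.
  have S : switchable G v u w t by decide_adj.
  by exists v, u, w, t; left; split; rewrite ?gdiff_sw.
have S : switchable H v w u t by decide_adj.
by exists v, w, u, t; right; split; rewrite // [gdiff G H]gdiffC gdiff_sw.
Qed.

Lemma tconn_all n (d : 'I_n -> nat) (G H : graph n) :
  (forall v, 3 <= d v) -> in_Gnd d G -> in_Gnd d H -> tconn G H.
Proof.
move=> d3.
have m3 K : in_Gnd d K -> min3 K by case=> sK dK; split=> // v; rewrite dK.
have [m] := ubnP #|gdiff G H|; elim: m G H => // m IH G H; rewrite ltnS => le_m dG dH.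
have [->|GH] := eqVneq G H; first exact: tconn_refl.
have [v [u [w [t [] [S lt]]]]] := exists_gdiff_sw dG dH GH.
  apply: tconn_trans (tconn_switch (m3 _ dG) S) (IH _ _ (leq_trans lt le_m) _ dH).
  exact: in_Gnd_sw.
(* A switch made in [H] is used backwards. *)
apply/tconn_sym; apply: tconn_trans (tconn_switch (m3 _ dH) S) (IH _ _ (leq_trans lt le_m) _ dG).
exact: in_Gnd_sw.
Qed.

(** * From triangle switches to transitions of the chain *)

Lemma triangle_switch_step (R : realFieldType) (lambda : R) n (G H : graph n) :
  (1 <= lambda)%R -> simple_graph G -> triangle_switch G H -> tswitch_step lambda G H.
Proof.
move=> l1 sG [a [b [c [d [v [S vS vG ->]]]]]].
exists a, b, c, d; split; first by move: S => /and5P[].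
exists [set [set a; c]; [set b; d]]; split.
- by rewrite !inE eqxx orbT.
- apply/setP => e; rewrite !inE; apply/negP=> /andP[eF /andP[_ eG]].
  by explode; case/orP: eF => /eqP E; move: eG; rewrite E -/(adj _ _ _); look.
- have mem p q : adj G v p -> adj G v q ->
      v \in (nbhd G p :&: nbhd G q) :\: [set a; b; c; d].
    by rewrite ![adj G v _]adjC => vp vq; move: vS; rewrite !inE vp vq !negb_or /= -!andbA andbT.
  by case/or4P: vG => /andP[vp vq];
    [exists a, b | exists c, d | exists a, c | exists b, d];
    (split; [by rewrite !inE eqxx ?orbT | by apply/set0Pn; exists v; apply: mem]).
- exact: sw_replace.
- by rewrite lt_min ltr01 exprz_gt0 // (lt_le_trans ltr01).
Qed.

Local Open Scope ring_scope.

Theorem theorem1 (R : realFieldType) (lambda : R) (n : nat) (d : 'I_n -> nat) :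
  (forall i j : 'I_n, (i <= j)%N -> (d j <= d i)%N) ->
  (forall i : 'I_n, (3 <= d i)%N) ->
  (exists G : graph n, in_Gnd d G) ->
  1 <= lambda ->
  forall G H : graph n, in_Gnd d G -> in_Gnd d H -> tswitch_reach lambda G H.
Proof.
move=> _ d3 _ l1 G H dG dH.
have := tconn_all d3 dG dH.
(* Membership in the class is carried through the induction, since [triangle_switch_step] asks for a
   simple graph at each step. *)
suff: forall K, tconn G K -> in_Gnd d K /\ tswitch_reach lambda G K by move=> + /[dup] T => /(_ _ T)[].
move=> K; elim=> [|K' L _ [dK' reach] KL]; first by split; [|apply: tsr_refl].
split; last by apply: tsr_step reach _; apply: triangle_switch_step KL; case: dK'.
by case: KL => a [b [c [e [v [S _ _ ->]]]]]; apply: in_Gnd_sw.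
Qed.
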